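(* Let $L\ge0$ be an integer and $\lambda\in[0,1]$. Let $P_{\mathrm{NMDT}}$ be the depth-$L$ NMDT MIP relaxation and $P_{\mathrm{D\text{-}NMDT}}$ the depth-$L$ D-NMDT MIP relaxation (with parameter $\lambda$) of $z=xy$ over $x,y\in[0,1]$. Their respective average error widths are $$\mathcal E^{\mathrm{avg}}\bigl(P_{\mathrm{NMDT}},\operatorname{gra}_{[0,1]^2}(xy)\bigr)=\tfrac16\,2^{-L}\qquad\text{and}\qquad \mathcal E^{\mathrm{avg}}\bigl(P_{\mathrm{D\text{-}NMDT}},\operatorname{gra}_{[0,1]^2}(xy)\bigr)=\tfrac16\,2^{-2L}.$$
   Context: McCormick envelope: for quantities $p\in[\underline p,\overline p]$, $q\in[\underline q,\overline q]$, $\mathcal M(p,q)$ denotes the set of $(p,q,r)\in[\underline p,\overline p]\times[\underline q,\overline q]\times\mathbb R$ with $\underline p q+p\underline q-\underline p\,\underline q\le r\le \overline p q+p\underline q-\overline p\,\underline q$ and $\overline p q+p\overline q-\overline p\,\overline q\le r\le \underline p q+p\overline q-\underline p\,\overline q$. For a binary variable the bounds used are $[0,1]$. Depth-$L$ NMDT MIP relaxation $P_{\mathrm{NMDT}}$ of $z=xy$: the set of all $(x,y,z,\Delta_x,\Delta_z,u,\beta)$ with $x,z,\Delta_z\in\mathbb R$, $u\in\mathbb R^L$, satisfying $x=\sum_{j=1}^L2^{-j}\beta_j+\Delta_x$; $z=\sum_{j=1}^L2^{-j}u_j+\Delta_z$; $(y,\beta_j,u_j)\in\mathcal M(y,\beta_j)$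 for $j=1,\dots,L$; $(\Delta_x,y,\Delta_z)\in\mathcal M(\Delta_x,y)$; $\Delta_x\in[0,2^{-L}]$, $y\in[0,1]$, $\beta\in\{0,1\}^L$. (The bounds in the McCormick envelopes are $y\in[0,1]$ and $\Delta_x\in[0,2^{-L}]$.) Depth-$L$ D-NMDT MIP relaxation $P_{\mathrm{D\text{-}NMDT}}$ of $z=xy$ with parameter $\lambda\in[0,1]$: the set of all $(x,y,z,\Delta_x,\Delta_y,\Delta_z,u,v,\beta^x,\beta^y)$ with $z,\Delta_z\in\mathbb R$, $u,v\in\mathbb R^L$, satisfying $x=\sum_{j=1}^L2^{-j}\beta^x_j+\Delta_x$; $y=\sum_{j=1}^L2^{-j}\beta^y_j+\Delta_y$; $z=\sum_{j=1}^L2^{-j}(u_j+v_j)+\Delta_z$; $(\lambda\Delta_y+(1-\lambda)y,\beta^x_j,u_j)\in\mathcal M(\lambda\Delta_y+(1-\lambda)y,\beta^x_j)$ and $((1-\lambda)\Delta_x+\lambda x,\beta^y_j,v_j)\in\mathcal M((1-\lambda)\Delta_x+\lambda x,\beta^y_j)$ for $j=1,\dots,L$; $(\Delta_x,\Delta_y,\Delta_z)\in\mathcal M(\Delta_x,\Delta_y)$; $\Delta_x,\Delta_y\in[0,2^{-L}]$, $x,y\in[0,1]$, $\beta^x,\beta^y\in\{0,1\}^L$. The bounds used in the McCormick envelopes are $\lambda\Delta_y+(1-\lambda)y\in[0,\lambda2^{-L}+(1-\lambda)]$, $(1-\lambda)\Delta_x+\lambda x\in[0,(1-\lambda)2^{-L}+\lambda]$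 and $\Delta_x,\Delta_y\in[0,2^{-L}]$. For $L=0$ the sums are empty and there are no binary variables. Let $\operatorname{gra}_{[0,1]^2}(xy)=\{(x,y,z)\in[0,1]^2\times\mathbb R: z=xy\}$. The average error (width) $\mathcal E^{\mathrm{avg}}(P,U)$ of a relaxation $P$ with respect to $U=\operatorname{gra}_{[0,1]^2}(xy)$ is the three-dimensional volume (Lebesgue measure) of $\operatorname{proj}_{(x,y,z)}(P)\setminus U$, where $\operatorname{proj}_{(x,y,z)}(P)$ is the projection of $P$ onto the $(x,y,z)$-space. *)

(* Defs.v *)
From HB Require Import structures.
From mathcomp Require Import all_boot all_order all_algebra.
From mathcomp Require Import all_classical all_reals all_analysis.
Import Order.TTheory GRing.Theory Num.Theory.

Set Implicit Arguments.
Unset Strict Implicit.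
Unset Printing Implicit Defensive.

Local Open Scope classical_set_scope.
Local Open Scope ring_scope.

Definition mccormick (R : realType) (pl pu ql qu : R) : set (R * R * R) :=
  [set t | let: (p, q, r) := t in
    [/\ pl <= p <= pu,
        ql <= q <= qu,
        pl * q + p * ql - pl * ql <= r <= pu * q + p * ql - pu * ql
      & pu * q + p * qu - pu * qu <= r <= pl * q + p * qu - pl * qu]].

(* The index j : 'I_L counts from 0, so it stands for j + 1 in 1, ..., L;
   hence the weights 2 ^- j.+1.  Binary vectors are boolean-valued, and are
   cast into R by %:R.

   The points of both relaxations are grouped as ((x, y, z), auxiliary
   variables), so that the projection onto (x, y, z)-space is fst. *)

Definition P_NMDT (R : realType) (L : nat) :=
  [set w : (R * R * R) * (R * R * 'rV[R]_L * {ffun 'I_L -> bool}) |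
    let: ((x, y, z), (dx, dz, u, b)) := w in
    [/\ x = \sum_(j < L) 2 ^- j.+1 * (b j)%:R + dx,
        z = \sum_(j < L) 2 ^- j.+1 * u 0 j + dz,
        forall j : 'I_L, mccormick 0 1 0 1 (y, (b j)%:R, u 0 j),
        mccormick 0 (2 ^- L) 0 1 (dx, y, dz)
      & 0 <= dx <= 2 ^- L /\ 0 <= y <= 1]].

Definition P_DNMDT (R : realType) (L : nat) (lam : R) :=
  [set w : (R * R * R) *
           (R * R * R * 'rV[R]_L * 'rV[R]_L *
            {ffun 'I_L -> bool} * {ffun 'I_L -> bool}) |
    let: ((x, y, z), (dx, dy, dz, u, v, bx, by_)) := w in
    [/\ [/\ x = \sum_(j < L) 2 ^- j.+1 * (bx j)%:R + dx,
            y = \sum_(j < L) 2 ^- j.+1 * (by_ j)%:R + dy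
          & z = \sum_(j < L) 2 ^- j.+1 * (u 0 j + v 0 j) + dz],
        forall j : 'I_L,
          mccormick 0 (lam * 2 ^- L + (1 - lam)) 0 1
            (lam * dy + (1 - lam) * y, (bx j)%:R, u 0 j),
        forall j : 'I_L,
          mccormick 0 ((1 - lam) * 2 ^- L + lam) 0 1
            ((1 - lam) * dx + lam * x, (by_ j)%:R, v 0 j),
        mccormick 0 (2 ^- L) 0 (2 ^- L) (dx, dy, dz)
      & [/\ 0 <= dx <= 2 ^- L, 0 <= dy <= 2 ^- L, 0 <= x <= 1 & 0 <= y <= 1]]].

Definition gra_xy (R : realType) : set (R * R * R) :=
  [set t | let: (x, y, z) := t in
    [/\ 0 <= x <= 1, 0 <= y <= 1 & z = x * y]].

Definition lebesgue_measure3 (R : realType) : set (R * R * R) -> \bar R :=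
  ((@lebesgue_measure R \x @lebesgue_measure R) \x @lebesgue_measure R)%E.

Definition avg_error (R : realType) (T : Type) (P : set ((R * R * R) * T))
    (U : set (R * R * R)) : \bar R :=
  lebesgue_measure3 ((fst @` P) `\` U).

(* Main.v *)
(* For binary digits the McCormick envelopes of the digit products are exact, so
   both projections consist, over each cell of a dyadic grid of the unit square
   (a x 1 cells with a = 2^-L for NMDT, a x a cells for D-NMDT), of xy plus the
   error r - pq of the McCormick envelope of the local coordinates (p, q); for
   D-NMDT the parameter lambda cancels.  On cell boundaries the envelope is
   exact, so neighbouring cells agree there.  By Tonelli, an a x b cell
   contributes a^2 b^2 / 6, and there are 1 / (a b) cells. *)
Require Import Defs.
From mathcomp Require Import all_boot all_order all_algebra.
From mathcomp Require Import all_classical all_reals all_analysis.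
From mathcomp Require Import measurable_realfun.
From mathcomp Require Import ring lra zify.
Import Order.TTheory GRing.Theory Num.Theory.
Import numFieldNormedType.Exports.
Set Implicit Arguments.
Unset Strict Implicit.
Unset Printing Implicit Defensive.
Local Open Scope classical_set_scope.
Local Open Scope ring_scope.

(** * One-variable calculus *)

Lemma integral_itvoo_FTC (R : realType) (f F : R -> R) (c d : R) :
  c < d -> continuous f -> (forall x : R, is_derive x 1 F (f x)) ->
  (\int[@lebesgue_measure R]_(x in `]c, d[) (f x)%:E = (F d - F c)%:E)%E.
Proof.
move=> cd cf dF.
have cF : continuous F.
  by move=> x; apply: differentiable_continuous; apply/derivable1_diffP; case: (dF x).
rewrite (@integral_itv_bndo_bndc _ (BRight c)); last first.
  by apply/measurable_EFinP; apply: measurable_funTS; exact: continuous_measurable_fun.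
rewrite integral_itv_obnd_cbnd; last first.
  by apply/measurable_EFinP; apply: measurable_funTS; exact: continuous_measurable_fun.
rewrite (@continuous_FTC2 _ f F) //.
- exact: continuous_subspaceT.
- split.
  + by move=> x _; case: (dF x).
  + by apply: cvg_at_right_filter; exact: cF.
  + by apply: cvg_at_left_filter; exact: cF.
- by move=> x _; rewrite derive1E derive_val.
Qed.

(** Squaring removes the kink of the positive part at 0. This supplies antiderivatives for the two
    positive parts in [height]. *)
Lemma is_derive_max0_sqr (R : realType) (x : R) :
  is_derive x 1 (fun t : R => Num.max 0 t ^+ 2) (2 * Num.max 0 x).
Proof.
have [x0|x0|->] := ltgtP x 0.
- rewrite mulr0; apply: (near_eq_is_derive (f := cst 0)).
  near=> t; rewrite /= max_l ?expr0n//.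
  by apply/ltW; near: t; apply: lt_nbhsl.
- apply: (near_eq_is_derive (f := fun t : R => t ^+ 2)).
    near=> t; rewrite max_r //.
    by apply/ltW; near: t; apply: lt_nbhsr.
  by apply: is_derive_eq; rewrite /GRing.scale /=; ring.
- rewrite mulr0.
  (* At 0 the difference quotient is [h] for [h > 0] and 0 for [h < 0], so it is bounded by
     [|h|]. *)
  have C : (fun h => h^-1 *: (Num.max 0 (h *: (1 : R) + 0 : R) ^+ 2
      - Num.max (0 : R) 0 ^+ 2)) @ (0 : R)^' --> (0 : R).
    apply/cvgr0Pnorm_lt => e e0.
    near=> h.
    have h0 : h != 0 by near: h; apply: nbhs_dnbhs_neq.
    have he : `|h| < e.
      by near: h; exact: dnbhs0_lt.
    rewrite /GRing.scale /= mulr1 addr0 maxxx expr0n subr0.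
    have [hp|hn] := leP 0 h; last by rewrite expr0n mulr0 normr0.
    by rewrite expr2 mulrA mulVf // mul1r.
  apply: DeriveDef; first by apply/cvg_ex; exists 0.
  exact: cvg_lim C.
Unshelve. all: by end_near.
Qed.

(* The length of the interval [max(0, bp + aq - ab), min(aq, bp)] of values allowed
   by the McCormick envelope, with both extrema written as positive parts. *)
Definition height (R : realType) (a b p q : R) : R :=
  a * q - Num.max 0 (a * q - b * p) - Num.max 0 (b * p + a * q - a * b).

(** [height a b p q] is the least of the four nonnegative products [a * q], [b * p], [(a - p) * b]
    and [(b - q) * a]. *)
Lemma height_ge0 (R : realType) (a b p q : R) :
  0 <= p <= a -> 0 <= q <= b -> 0 <= height a b p q.
Proof.
move=> /andP[p0 pa] /andP[q0 qb]; rewrite /height.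
have := mulr_ge0 q0 (le_trans p0 pa).
have := mulr_ge0 p0 (le_trans q0 qb).
have : 0 <= (a - p) * b by rewrite mulr_ge0 ?subr_ge0// (le_trans q0).
have : 0 <= (b - q) * a by rewrite mulr_ge0 ?subr_ge0// (le_trans p0).
have [h1|h1] := leP 0 (a * q - b * p);
  have [h2|h2] := leP 0 (b * p + a * q - a * b); nra.
Qed.

Lemma integral_height_snd (R : realType) (a b p c : R) :
  0 < a -> 0 < b -> 0 <= p <= a ->
  (\int[@lebesgue_measure R]_(y in `]c, (c + b)%R[) (height a b p (y - c)%R)%:E =
   (b ^+ 2 * p * (a - p) / a)%R%:E)%E.
Proof.
move=> a0 b0 /andP[p0 pa].
(* An antiderivative, term by term; the factor [(2 * a)^-1] undoes the chain rule for the slope [a]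
   and the exponent 2. *)
pose F (y : R) := a / 2 * (y - c) ^+ 2
  - (2 * a)^-1 * (Num.max 0 (a * (y - c) - b * p)) ^+ 2
  - (2 * a)^-1 * (Num.max 0 (b * p + a * (y - c) - a * b)) ^+ 2.
have dmax (k : R) (x : R) : is_derive x 1
    (fun t : R => (Num.max 0 (a * t + k)) ^+ 2) (a * (2 * Num.max 0 (a * x + k))).
  have dg : is_derive x (1 : R) (fun t : R => a * t + k) a.
    by apply: is_derive_eq; rewrite /GRing.scale /=; ring.
  have := is_derive1_comp (f := fun t : R => Num.max 0 t ^+ 2)
    (g := fun t : R => a * t + k) (is_derive_max0_sqr (a * x + k)) dg.
  by move=> H; apply: (is_derive_eq H); rewrite /GRing.scale /=; ring.
have ch : continuous (fun y : R => height a b p (y - c)).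
  have lin (k : R) : continuous (fun y : R => a * y + k).
    move=> y; apply: cvgD; last exact: cvg_cst.
    by apply: cvgM; [exact: cvg_cst|exact: cvg_id].
  have cmax (k : R) : continuous (fun y : R => Num.max 0 (a * y + k)).
    move=> y; apply: (@continuous_max R R (cst 0) (fun y : R => a * y + k)).
      exact: cst_continuous.
    exact: lin.
  rewrite (_ : (fun _ => _) = fun y => (a * y + - a * c)
     - Num.max 0 (a * y + (- a * c - b * p))
     - Num.max 0 (a * y + (b * p - a * c - a * b))).
    by move=> y; apply: cvgB; [apply: cvgB; [exact: lin|exact: cmax]|exact: cmax].
  by apply/funext => y; rewrite /height; congr (_ - Num.max 0 _ - Num.max 0 _); ring.
have dF (x : R) : is_derive x 1 F (height a b p (x - c)).
  rewrite /F (_ : (fun _ => _) = fun y => a / 2 * (y - c) ^+ 2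
    - (2 * a)^-1 * (Num.max 0 (a * y + (- a * c - b * p))) ^+ 2
    - (2 * a)^-1 * (Num.max 0 (a * y + (b * p - a * c - a * b))) ^+ 2); last first.
    apply/funext => y.
    by congr (_ - _ * Num.max 0 _ ^+ 2 - _ * Num.max 0 _ ^+ 2); ring.
  apply: is_derive_eq; rewrite /GRing.scale /= /height.
  have -> : a * x + (- a * c - b * p) = a * (x - c) - b * p by ring.
  have -> : a * x + (b * p - a * c - a * b) = b * p + a * (x - c) - a * b by ring.
  by field; rewrite gt_eqF.
have ccb : c < c + b by rewrite ltrDl.
rewrite (integral_itvoo_FTC ccb ch dF); congr (_%:E); rewrite /F.
have -> : c + b - c = b by ring.
(* At [y = c + b] both positive parts are active, at [y = c] both vanish. What is left is b^2 (a^2 -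
   (a - p)^2 - p^2) / (2 a). *)
rewrite subrr !mulr0 (max_r (y := a * b - b * p)); last by nra.
rewrite (max_r (y := b * p + a * b - a * b)); last by nra.
rewrite (max_l (y := 0 - b * p)); last by nra.
rewrite (max_l (y := b * p + 0 - a * b)); last by nra.
by field; rewrite gt_eqF.
Qed.

Lemma integral_parabola (R : realType) (a c : R) : 0 < a ->
  (\int[@lebesgue_measure R]_(x in `]c, (c + a)%R[) ((x - c) * (a - (x - c)))%R%:E =
   (a ^+ 3 / 6)%R%:E)%E.
Proof.
move=> a0.
have cf : continuous (fun x : R => (x - c) * (a - (x - c))).
  move=> x; apply: cvgM; apply: cvgB; try exact: cvg_cst; try exact: cvg_id.
  by apply: cvgB; [exact: cvg_id|exact: cvg_cst].
have dF (x : R) : is_derive x 1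
    (fun x : R => a / 2 * (x - c) ^+ 2 - 3^-1 * (x - c) ^+ 3) ((x - c) * (a - (x - c))).
  by apply: is_derive_eq; rewrite /GRing.scale /=; field.
have cca : c < c + a by rewrite ltrDl.
by rewrite (integral_itvoo_FTC cca cf dF); congr (_%:E); field.
Qed.

(** The cell is taken open so that distinct grid cells are disjoint: at any point at most one term
    of a sum over the cells is nonzero. *)
Definition cell_height (R : realType) (a b c d : R) : R * R -> \bar R :=
  (fun t => (height a b (t.1 - c) (t.2 - d))%:E) \_ (`]c, (c + a)[ `*` `]d, (d + b)[).

Lemma cell_heightE (R : realType) (a b c d x y : R) : cell_height a b c d (x, y) =
  if (c < x < c + a) && (d < y < d + b) then (height a b (x - c) (y - d))%:E else 0%E.
Proof. by rewrite /cell_height patchE in_setX /= !mem_setE !in_itv. Qed.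

Lemma measurable_cell_height (R : realType) (a b c d : R) :
  measurable_fun [set: measurableTypeR R * measurableTypeR R] (cell_height a b c d).
Proof.
apply/(measurable_restrictT _ _).1; first exact: measurableX.
apply: measurable_funTS; apply/measurable_EFinP.
pose R2 := (measurableTypeR R * measurableTypeR R)%type.
have m1 k : measurable_fun [set: R2] (fun t : R2 => t.1 - k : R).
  by apply: measurable_funB => //; exact: measurable_fst.
have m2 k : measurable_fun [set: R2] (fun t : R2 => t.2 - k : R).
  by apply: measurable_funB => //; exact: measurable_snd.
rewrite /height.
apply: measurable_funB; [apply: measurable_funB|].
- by apply: measurable_funM.
- by apply: measurable_maxr => //; apply: measurable_funB; apply: measurable_funM.
- apply: measurable_maxr => //; apply: measurable_funB => //.
  by apply: measurable_funD; apply: measurable_funM.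
Qed.

Lemma cell_height_ge0 (R : realType) (a b c d : R) (t : R * R) :
  (0 <= cell_height a b c d t)%E.
Proof.
apply: erestrict_ge0 => -[x y] [] /=; rewrite !in_itv /= => /andP[? ?] /andP[? ?].
by rewrite lee_fin height_ge0; lra.
Qed.

(** Integrating in y first leaves (b^2 / a) p (a - p), a parabola in p whose integral over [0, a] is
    (b^2 / a) (a^3 / 6). *)
Lemma integral_cell_height (R : realType) (a b c d : R) : 0 < a -> 0 < b ->
  (\int[@lebesgue_measure R \x @lebesgue_measure R]_t cell_height a b c d t =
   (a ^+ 2 * b ^+ 2 / 6)%R%:E)%E.
Proof.
move=> a0 b0.
apply: (etrans (fubini_tonelli1 _ (@measurable_cell_height _ _ _ _ _)
  (@cell_height_ge0 _ _ _ _ _))).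
transitivity (\int[@lebesgue_measure R]_(x in `]c, (c + a)%R[)
    ((b ^+ 2 / a)%:E * ((x - c) * (a - (x - c)))%R%:E))%E.
  rewrite [RHS]integral_mkcond; apply: eq_integral => x _.
  rewrite /fubini_F patchE mem_setE in_itv /=.
  under eq_integral do rewrite cell_heightE.
  case: ifPn => [/andP[cx xca]|_]; last by apply: integral0_eq => y _.
  transitivity (\int[@lebesgue_measure R]_(y in `]d, (d + b)%R[)
      (height a b (x - c)%R (y - d)%R)%:E)%E.
    rewrite [RHS]integral_mkcond; apply: eq_integral => y _.
    by rewrite patchE mem_setE in_itv /=.
  rewrite integral_height_snd//; last lra.
  by rewrite -EFinM; congr (_%:E); field; rewrite gt_eqF.
rewrite ge0_integralZl//.
- by rewrite integral_parabola// -EFinM; congr (_%:E); field; rewrite gt_eqF.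
- apply/measurable_EFinP; apply: measurable_funTS.
  by apply: measurable_funM; apply: measurable_funB => //; apply: measurable_funB.
- move=> x /=; rewrite in_itv /= => /andP[? ?]; rewrite lee_fin; nra.
- by rewrite lee_fin divr_ge0// ?sqr_ge0 // ltW.
Qed.

(** * Volume of a grid of envelopes *)

(** Common form of both projections. In cell (i, j) the part x y - p q of the product is represented
    exactly by the digits, so only the remainder z - (x y - p q) is relaxed. Cells are closed here,
    hence overlap on their edges. *)
Definition grid_hull (R : realType) (a b : R) (N M : nat) : set (R * R * R) :=
  [set t | let: (x, y, z) := t in exists (i : 'I_N) (j : 'I_M),
    let p := x - i%:R * a in let q := y - j%:R * b in
    mccormick 0 a 0 b (p, q, z - x * y + p * q)].

Lemma mccormick0P (R : realType) (a b p q r : R) :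
  mccormick 0 a 0 b (p, q, r) <->
  [/\ 0 <= p <= a, 0 <= q <= b &
      Num.max 0 (b * p + a * q - a * b) <= r <= Num.min (a * q) (b * p)].
Proof.
rewrite /mccormick /= ge_max le_min; split.
  by case=> ? ? /andP[? ?] /andP[? ?]; split => //; apply/andP; split;
    apply/andP; split; lra.
by case=> ? ? /andP[/andP[? ?] /andP[? ?]]; split => //; apply/andP; split; lra.
Qed.

(** On each edge of the cell an upper and a lower bound of the envelope coincide. Points above the
    grid lines therefore lie on the graph and disappear with it. *)
Lemma mccormick0_edge (R : realType) (a b p q r : R) : 0 < a -> 0 < b ->
  mccormick 0 a 0 b (p, q, r) -> ~~ ((0 < p < a) && (0 < q < b)) -> r = p * q.
Proof.
move=> a0 b0 [/andP[p0 pa] /andP[q0 qb] /andP[r0 rq] /andP[r1 rp]].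
rewrite !negb_and -!leNgt => /orP[/orP[h|h]|/orP[h|h]].
- have -> : p = 0 by lra.
  nra.
- have -> : p = a by lra.
  nra.
- have -> : q = 0 by lra.
  nra.
- have -> : q = b by lra.
  nra.
Qed.

(** One cell is open and the other closed, to match [cell_height] against [grid_hull]. The bounds
    give i < k + 1 and k < i + 1. *)
Lemma cell_uniq (R : realType) (a x : R) (i k : nat) : 0 < a ->
  i%:R * a < x < i%:R * a + a -> k%:R * a <= x <= k%:R * a + a -> i = k.
Proof.
move=> a0 /andP[ix xi] /andP[kx xk].
have : i%:R * a < k.+1%:R * a by rewrite -natr1 mulrDl mul1r; lra.
have : k%:R * a < i.+1%:R * a by rewrite -natr1 mulrDl mul1r; lra.
by rewrite !ltr_pM2r// !ltr_nat; lia.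
Qed.

Lemma cell_sub01 (R : realType) (a x : R) (N : nat) (i : 'I_N) : 0 < a ->
  N%:R * a = 1 -> i%:R * a <= x <= i%:R * a + a -> 0 <= x <= 1.
Proof.
move=> a0 Na /andP[ix xi].
have : 0 <= i%:R * a by rewrite mulr_ge0// ltW.
have : i.+1%:R * a <= N%:R * a by rewrite ler_pM2r// ler_nat.
by rewrite -natr1 mulrDl mul1r; lra.
Qed.

(** Above a point (x, y) of the unit square the graph is the single point [v = x * y], a null
    set. *)
Lemma lebesgue_measure_itvccD1 (R : realType) (c d v : R) : c <= d ->
  @lebesgue_measure R (`[c, d] `\ v) = (d - c)%:E.
Proof.
move=> cd.
have nullv : lebesgue_measure (`[c, d] `&` [set v]) = 0%E.
  apply: (@subset_measure0 _ _ _ (@lebesgue_measure R) _ [set v]).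
  - exact: measurableI.
  - exact: measurable_set1.
  - exact: subIsetr.
  - exact: lebesgue_measure_set1.
apply: (etrans (esym (adde0 _))); rewrite -nullv.
apply: (etrans (esym (measureDI (@lebesgue_measure R) (measurable_itv `[c, d])
  (measurable_set1 v)))).
apply: (etrans (lebesgue_measure_itv _)); rewrite /= lte_fin.
by case: ltP => // dc; rewrite (@le_anti _ _ c d) ?cd// subrr.
Qed.

(** Above an open cell only the envelope of that cell is met, and the section is an interval without
    the point x y. Above any other (x, y) the section is empty, by [mccormick0_edge]. *)
Lemma measure_section_grid_hull (R : realType) (a b x y : R) (N M : nat) :
  0 < a -> 0 < b -> N%:R * a = 1 -> M%:R * b = 1 ->
  lebesgue_measure (xsection (@grid_hull R a b N M `\` @gra_xy R) (x, y)) =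
  (\sum_(k : 'I_N * 'I_M) cell_height a b (k.1%:R * a) (k.2%:R * b) (x, y))%E.
Proof.
move=> a0 b0 Na Mb.
have [[i [j [xi yj]]]|ncell] := pselect (exists (i : 'I_N) (j : 'I_M),
    i%:R * a < x < i%:R * a + a /\ j%:R * b < y < j%:R * b + b).
- rewrite (bigD1 (i, j)) //= big1 ?adde0; last first.
    move=> [i' j'] /eqP nij; rewrite cell_heightE; case: ifPn => // /andP[xi' yj'].
    exfalso; apply: nij; congr pair; apply: val_inj => /=; apply: esym.
      by apply: (cell_uniq a0 xi); case/andP: xi' => ? ?; lra.
    by apply: (cell_uniq b0 yj); case/andP: yj' => ? ?; lra.
  rewrite cell_heightE xi yj /=.
  set p := x - i%:R * a; set q := y - j%:R * b.
  have p0 : 0 <= p <= a by case/andP: xi; rewrite /p => ? ?; lra.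
  have q0 : 0 <= q <= b by case/andP: yj; rewrite /q => ? ?; lra.
  (* The ends of the envelope interval for r, shifted by x y - p q to become bounds on z. *)
  have -> : height a b p q =
      x * y - p * q + Num.min (a * q) (b * p) -
      (x * y - p * q + Num.max 0 (b * p + a * q - a * b)).
    rewrite /height; have [?|?] := leP 0 (a * q - b * p);
    have [?|?] := leP (a * q) (b * p); lra.
  rewrite -(@lebesgue_measure_itvccD1 _ _ _ (x * y)); last first.
    have := height_ge0 p0 q0.
    rewrite /height; have [?|?] := leP 0 (a * q - b * p);
    have [?|?] := leP (a * q) (b * p); lra.
  congr (lebesgue_measure _); apply/seteqP; split => z /=.
    rewrite /xsection /= inE => -[/= [i' [j' /mccormick0P[pa qb rab]]] ngra].
    have Ei : i = i' by apply/val_inj/(cell_uniq a0 xi); lra.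
    have Ej : j = j' by apply/val_inj/(cell_uniq b0 yj); lra.
    move: rab; rewrite -Ei -Ej -/p -/q => rab; split.
      by rewrite in_itv /=; lra.
    move=> zxy; apply: ngra; split => //.
      by apply: (cell_sub01 (i := i') a0 Na); lra.
    by apply: (cell_sub01 (i := j') b0 Mb); lra.
  rewrite in_itv /= => -[/andP[z1 z2] zxy]; rewrite /xsection /= inE; split => /=.
    exists i, j; apply/mccormick0P; split => //.
    by rewrite -/p -/q; lra.
  by case.
- rewrite big1 => [|[i j] _]; last first.
    rewrite cell_heightE; case: ifPn => // /andP[xi yj].
    by exfalso; apply: ncell; exists i, j.
  rewrite (_ : xsection _ _ = set0) ?measure0//.
  apply/seteqP; split => z //=; rewrite /xsection /= inE => -[[i [j mc]] ngra].
  apply: ngra; case/mccormick0P: (mc) => pa qb _; split.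
  + by apply: (cell_sub01 (i := i) a0 Na); lra.
  + by apply: (cell_sub01 (i := j) b0 Mb); lra.
  + have := mccormick0_edge a0 b0 mc.
    case: (boolP (_ && _)) => [/andP[xi yj]|_ /(_ isT)]; last by lra.
    by exfalso; apply: ncell; exists i, j; split; lra.
Qed.

Lemma lebesgue_measure3_grid_hull (R : realType) (a b : R) (N M : nat) :
  0 < a -> 0 < b -> N%:R * a = 1 -> M%:R * b = 1 ->
  lebesgue_measure3 (@grid_hull R a b N M `\` @gra_xy R) = (a * b / 6)%:E.
Proof.
move=> a0 b0 Na Mb.
(* The product measure is by definition the integral over (x, y) of the measure of the section in
   z. *)
transitivity (\int[@lebesgue_measure R \x @lebesgue_measure R]_t
    \sum_(k : 'I_N * 'I_M) cell_height a b (k.1%:R * a)%R (k.2%:R * b)%R t)%E.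
  by apply: eq_integral => -[x y] _; exact: measure_section_grid_hull.
apply: (etrans (ge0_integral_sum _ _ _ _ _)).
- exact: measurableT.
- by move=> k; exact: measurable_cell_height.
- by move=> k t _; exact: cell_height_ge0.
rewrite (eq_bigr (fun=> (a ^+ 2 * b ^+ 2 / 6)%:E)) => [|k _]; last first.
  exact: integral_cell_height.
rewrite sumEFin sumr_const card_prod !card_ord; congr (_%:E).
rewrite -[_ *+ (N * M)]mulr_natl natrM.
transitivity ((N%:R * a) * (M%:R * b) * (a * b / 6)); first by ring.
by rewrite Na Mb !mul1r.
Qed.

(** * Binary digits and the two projections *)

Lemma dyadic_digits_sum (R : realType) (L : nat) (b : 'I_L -> bool) :
  exists k : 'I_(2 ^ L), \sum_(j < L) 2 ^- j.+1 * (b j)%:R = k%:R * 2 ^- L :> R.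
Proof.
elim: L b => [|L IH] b.
  by exists (Ordinal (ltn0Sn 0)); rewrite big_ord0 mul0r.
have [k hk] := IH (fun j => b (widen_ord (leqnSn L) j)).
(* The last digit is the least significant one: appending it turns k into 2 k + digit. *)
have lt_k : (k.*2 + b ord_max < 2 ^ L.+1)%N.
  by rewrite expnS; have := ltn_ord k; case: (b _); lia.
exists (Ordinal lt_k); rewrite big_ord_recr /= hk natrD -muln2 natrM exprS.
by field; rewrite expf_neq0// pnatr_eq0.
Qed.

(** Digit [j] counts from the most significant end, so it is the bit of weight 2^(L - j - 1) in [k].
    The induction splits off the last bit, leaving [k./2]. *)
Lemma dyadic_digits (R : realType) (L k : nat) : (k < 2 ^ L)%N ->
  \sum_(j < L) 2 ^- j.+1 * (odd (k %/ 2 ^ (L - j.+1)))%:R = k%:R * 2 ^- L :> R.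
Proof.
elim: L k => [|L IH] k hk.
  by move: hk; rewrite expn0 ltnS leqn0 => /eqP ->; rewrite big_ord0 mul0r.
rewrite big_ord_recr /= subnn expn0 divn1.
rewrite (eq_bigr (fun j : 'I_L =>
    2 ^- j.+1 * (odd (k./2 %/ 2 ^ (L - j.+1)))%:R)); last first.
  by move=> j _; rewrite subSS -divn2 -divnMA -expnS subnSK.
rewrite IH; last by move: hk; rewrite expnS; lia.
rewrite -[X in _ = X%:R * _](odd_double_half k) natrD -muln2 natrM exprS.
by field; rewrite expf_neq0// pnatr_eq0.
Qed.

(** At q = 0 the first pair of bounds pinches r to 0; at q = 1 the second pair pinches r to p. *)
Lemma mccormick_bool (R : realType) (P p r : R) (b : bool) : 0 <= p <= P ->
  mccormick 0 P 0 1 (p, b%:R, r) <-> r = p * b%:R.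
Proof.
case: b; rewrite /mccormick ?mulr1n ?mulr0n => /andP[p0 pP]; split;
  by [case=> _ _ /andP[? ?] /andP[? ?]; lra
     |move=> ->; split; apply/andP; split; lra].
Qed.

Lemma natr_expn2V (R : realType) (L : nat) : (2 ^ L)%N%:R * 2 ^- L = 1 :> R.
Proof. by rewrite natrX mulfV// expf_neq0// pnatr_eq0. Qed.

(** Only x is discretised, so the grid has a single row of height 1 and the local coordinate q is y
    itself. *)
Lemma proj_P_NMDT (R : realType) (L : nat) :
  fst @` @P_NMDT R L = @grid_hull R (2 ^- L) 1 (2 ^ L) 1.
Proof.
apply/seteqP; split => [_ [[[[x y] z] [[[dx dz] u] b]]
    [xE zE uP dP [dxB yB]] <-] /=|[[x y] z]].
  have [k kE] := dyadic_digits_sum R b; exists k, ord0.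
  have uE : \sum_(j < L) 2 ^- j.+1 * u 0 j = y * (k%:R * 2 ^- L).
    rewrite -kE mulr_sumr; apply: eq_bigr => j _.
    by rewrite ((mccormick_bool _ _ yB).1 (uP j)); ring.
  rewrite uE in zE; rewrite kE in xE.
  have -> : x - k%:R * 2 ^- L = dx by lra.
  have -> : y - 0%:R * 1 = y by ring.
  by have -> : z - x * y + dx * y = dz by rewrite zE xE; ring.
move=> /= [k [l]]; rewrite ord1 (_ : y - _ = y) => [mc|]; last by rewrite mul0r subr0.
(* The digits are those of the cell index; [mccormick_bool] then forces [u] to be the exact
   products. *)
pose b := [ffun j : 'I_L => odd (k %/ 2 ^ (L - j.+1))].
have bE : \sum_(j < L) 2 ^- j.+1 * (b j)%:R = k%:R * 2 ^- L :> R.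
  by rewrite -(dyadic_digits _ (ltn_ord k)); apply: eq_bigr => j _; rewrite ffunE.
set dx := x - k%:R * 2 ^- L in mc.
set dz := z - x * y + dx * y in mc.
have [dxB yB _ _] := mc.
exists ((x, y, z), (dx, dz, \row_j (y * (b j)%:R), b)) => //=.
split => //.
- by rewrite bE /dx; ring.
- rewrite (eq_bigr (fun j : 'I_L => y * (2 ^- j.+1 * (b j)%:R))); last first.
    by move=> j _; rewrite mxE; ring.
  by rewrite -mulr_sumr bE /dz /dx; ring.
- by move=> j; apply/mccormick_bool; rewrite ?mxE.
Qed.

(** Put X = x - dx and Y = y - dy. The mixed factors are s = y - lam Y and t = x - (1 - lam) X, so s
    X + t Y = y X + x Y - X Y = x y - dx dy, which is free of lam. *)
Lemma proj_P_DNMDT (R : realType) (L : nat) (lam : R) : 0 <= lam <= 1 ->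
  fst @` @P_DNMDT R L lam = @grid_hull R (2 ^- L) (2 ^- L) (2 ^ L) (2 ^ L).
Proof.
move=> /andP[lam0 lam1].
have w0 : 0 < 2 ^- L :> R by rewrite invr_gt0 exprn_gt0.
have Nw := natr_expn2V R L.
(* The mixed factors respect the bounds used in their envelopes, as [mccormick_bool] requires. *)
have mixB (t d e : R) : 0 <= t <= 1 -> 0 <= d <= 2 ^- L -> 0 <= e <= 1 ->
    0 <= t * d + (1 - t) * e <= t * 2 ^- L + (1 - t).
  move=> /andP[? ?] /andP[? ?] /andP[? ?].
  have ? : 0 <= t * (2 ^- L - d) by apply: mulr_ge0; lra.
  have ? : 0 <= (1 - t) * (1 - e) by apply: mulr_ge0; lra.
  have ? : 0 <= t * d by apply: mulr_ge0; lra.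
  have ? : 0 <= (1 - t) * e by apply: mulr_ge0; lra.
  by apply/andP; split; lra.
have lamB : 0 <= lam <= 1 by lra.
have lamB' : 0 <= 1 - lam <= 1 by lra.
have mixB' (d e : R) : 0 <= d <= 2 ^- L -> 0 <= e <= 1 ->
    0 <= (1 - lam) * d + lam * e <= (1 - lam) * 2 ^- L + lam.
  by move=> dB eB; have := mixB _ d e lamB' dB eB; rewrite subKr.
apply/seteqP; split => [_ [[[[x y] z] [[[[[[dx dy] dz] u] v] bx] by_]]
    [[xE yE zE] uP vP dP [dxB dyB xB yB]] <-] /=|[[x y] z]].
  have [k kE] := dyadic_digits_sum R bx; have [l lE] := dyadic_digits_sum R by_.
  exists k, l.
  rewrite kE in xE; rewrite lE in yE.
  have uvE : \sum_(j < L) 2 ^- j.+1 * (u 0 j + v 0 j) =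
      (lam * dy + (1 - lam) * y) * (k%:R * 2 ^- L) +
      ((1 - lam) * dx + lam * x) * (l%:R * 2 ^- L).
    rewrite -kE -lE !mulr_sumr -big_split; apply: eq_bigr => j _ /=.
    rewrite ((mccormick_bool _ _ (mixB _ _ _ lamB dyB yB)).1 (uP j)).
    by rewrite ((mccormick_bool _ _ (mixB' _ _ dxB xB)).1 (vP j)); ring.
  rewrite uvE in zE.
  have -> : x - k%:R * 2 ^- L = dx by lra.
  have -> : y - l%:R * 2 ^- L = dy by lra.
  by have -> : z - x * y + dx * dy = dz by rewrite zE xE yE; ring.
move=> /= [k [l mc]].
pose digits (k : nat) := [ffun j : 'I_L => odd (k %/ 2 ^ (L - j.+1))].
have digitsE (k' : 'I_(2 ^ L)) :
    \sum_(j < L) 2 ^- j.+1 * (digits k' j)%:R = k'%:R * 2 ^- L :> R.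
  by rewrite -(dyadic_digits _ (ltn_ord k')); apply: eq_bigr => j _; rewrite ffunE.
set dx := x - k%:R * 2 ^- L in mc; set dy := y - l%:R * 2 ^- L in mc.
set dz := z - x * y + dx * dy in mc.
have [dxB dyB _ _] := mc.
have xB : 0 <= x <= 1 by apply: (cell_sub01 (i := k) w0 Nw); move: dxB; rewrite /dx; lra.
have yB : 0 <= y <= 1 by apply: (cell_sub01 (i := l) w0 Nw); move: dyB; rewrite /dy; lra.
pose s := lam * dy + (1 - lam) * y; pose t := (1 - lam) * dx + lam * x.
exists ((x, y, z), (dx, dy, dz, \row_j (s * (digits k j)%:R),
  \row_j (t * (digits l j)%:R), digits k, digits l)) => //=.
split => //.
- split.
  + by rewrite digitsE /dx; ring.
  + by rewrite digitsE /dy; ring.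
  + rewrite (eq_bigr (fun j : 'I_L => s * (2 ^- j.+1 * (digits k j)%:R) +
        t * (2 ^- j.+1 * (digits l j)%:R))); last by move=> j _; rewrite !mxE; ring.
    by rewrite big_split -!mulr_sumr !digitsE /dz /s /t /dx /dy /=; ring.
- by move=> j; apply/mccormick_bool; rewrite ?mxE//; exact: mixB.
- by move=> j; apply/mccormick_bool; rewrite ?mxE//; exact: mixB'.
Qed.

Theorem proposition5 (R : realType) (L : nat) (lam : R)
    (hlam : 0 <= lam <= 1) :
  avg_error (@P_NMDT R L) (@gra_xy R) = (6^-1 * 2 ^- L)%:E /\
  avg_error (@P_DNMDT R L lam) (@gra_xy R) = (6^-1 * 2 ^- (2 * L))%:E.
Proof.
have w0 : 0 < 2 ^- L :> R by rewrite invr_gt0 exprn_gt0.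
have Nw := natr_expn2V R L.
rewrite /avg_error proj_P_NMDT proj_P_DNMDT//.
(* The cell area [a * b] is [2 ^- L] for NMDT and its square for D-NMDT. *)
rewrite !lebesgue_measure3_grid_hull ?mulr1//; split; first by rewrite mulrC.
by rewrite -invfM -exprD addnn -mul2n mulrC.
Qed.
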